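(* Let $m \in \{0,\ldots,M-1\}$ and let $\vec X^m \in \underline{V}^h$ with $\vec X^m(q_j) \in H$ for $j=1,\ldots,J$ and $|\vec X^m_\rho| > 0$ for almost all $\rho \in I$. (i) Let $(\vec X^{m+1}, \kappa_g^{m+1}) \in \underline{V}^h \times V^h$, with $\vec X^{m+1}(q_j) \in H$ for $j=1,\ldots,J$, be a solution of the scheme $(\mathcal C_{m,\star})^h$: $$\left(g(\vec X^m)\,\frac{\vec X^{m+1} - \vec X^m}{\Delta t_m}, \chi\,\vec\nu^m\,|\vec X^m_\rho|\right)^h = \left(g^{\frac12}(\vec X^m)\,\kappa_g^{m+1}, \chi\,|\vec X^m_\rho|\right)^h \qquad \forall\ \chi \in V^h ,$$ $$\left(g(\vec X^m)\,\kappa_g^{m+1}\,\vec\nu^m, \vec\eta\,|\vec X^m_\rho|\right)^h + \left( \nabla\,[g^{\frac12}_+(\vec X^{m+1}) + g^{\frac12}_-(\vec X^m)], \vec\eta\, |\vec X^{m+1}_\rho| \right)^h + \left( g^{\frac12}(\vec X^m)\, \vec X^{m+1}_\rho,\vec\eta_\rho\, |\vec X^m_\rho|^{-1} \right)^h = 0 \qquad \forall\ \vec\eta \in \underline{V}^h .$$ Then $$L_g^h(\vec X^{m+1}) + \Delta t_m \left(g^{\frac12}(\vec X^m)\,|\kappa_g^{m+1}|^2, |\vec X^m_\rho|\right)^h \leq L_g^h(\vec X^m) .$$ (ii) Let $(\vec X^{m+1}, \vec\kappa_g^{m+1}) \in \underline{V}^h \times \underline{V}^h$, with $\vec X^{m+1}(q_j)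 \in H$ for $j=1,\ldots,J$, be a solution of the scheme $(\mathcal D_{m,\star})^h$: $$\left(g(\vec X^m)\,\frac{\vec X^{m+1} - \vec X^m}{\Delta t_m}, \vec\chi\,|\vec X^m_\rho|\right)^h = \left(g(\vec X^m)\,\vec\kappa_g^{m+1}, \vec\chi\,|\vec X^m_\rho|\right)^h \qquad \forall\ \vec\chi \in \underline{V}^h ,$$ $$\left(g^{\frac32}(\vec X^m)\,\vec\kappa_g^{m+1}, \vec\eta\,|\vec X^m_\rho|\right)^h + \left( \nabla\,[g^{\frac12}_+(\vec X^{m+1}) + g^{\frac12}_-(\vec X^m)], \vec\eta\, |\vec X^{m+1}_\rho| \right)^h + \left( g^{\frac12}(\vec X^m)\, \vec X^{m+1}_\rho,\vec\eta_\rho\, |\vec X^m_\rho|^{-1} \right)^h = 0 \qquad \forall\ \vec\eta \in \underline{V}^h .$$ Then $$L_g^h(\vec X^{m+1}) + \Delta t_m \left(g^{\frac32}(\vec X^m)\,|\vec\kappa_g^{m+1}|^2, |\vec X^m_\rho|\right)^h \leq L_g^h(\vec X^m) .$$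
   Context: Let $H \subset \mathbb R^2$ be open and $g : H \to \mathbb R_{>0}$ a smooth function. It is assumed that $g^{\frac12}$ is split as $g^{\frac12} = g^{\frac12}_+ + g^{\frac12}_-$ with differentiable functions $g^{\frac12}_\pm : H \to \mathbb R$ such that $\pm g^{\frac12}_\pm$ is convex on $H$; here a differentiable $f : H \to \mathbb R$ is called convex on $H$ if $f(\vec u) \geq f(\vec v) + \nabla f(\vec v)\cdot(\vec u - \vec v)$ for all $\vec u,\vec v \in H$ (the usual notion when $H$ is convex). The expression $\nabla\,[g^{\frac12}_+(\vec X^{m+1}) + g^{\frac12}_-(\vec X^m)]$ means $(\nabla g^{\frac12}_+)(\vec X^{m+1}) + (\nabla g^{\frac12}_-)(\vec X^m)$. Let $I = \mathbb R/\mathbb Z$ be the periodic unit interval, $J \geq 3$, $h = J^{-1}$, $q_j = j\,h$ for $j=0,\ldots,J$ (with $q_0=0$ and $q_J=1$ identified) and $I_j = [q_{j-1},q_j]$, $j=1,\ldots,J$. Let $V^h = \{\chi \in C(I) : \chi|_{I_j} \text{ is linear for } j=1,\ldots,J\}$ and $\underline{V}^h = [V^h]^2$. Subscript $\rho$ denotes the derivative with respect to the variable $\rho \in I$. For piecewise continuous functions $u,v$ with possible jumps at the nodes $q_j$, the mass lumped inner product is $$(u,v)^h = \tfrac12 \sum_{j=1}^J h \left[ (u\,v)(q_j^-) + (u\,v)(q_{j-1}^+) \right], \qquad u(q_j^\pm) = \lim_{\delta\searrow0} u(q_j\pm\delta).$$ It extends naturally to vector-valued functions, using the Euclidean dot product.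 Time steps: $0=t_0<t_1<\dots<t_M=T$ and $\Delta t_m = t_{m+1}-t_m > 0$. For $\vec X^m \in \underline{V}^h$ with $|\vec X^m_\rho|>0$ almost everywhere, $\vec\nu^m = - [\vec X^m_\rho]^\perp / |\vec X^m_\rho|$ (a piecewise constant unit normal), where $\cdot^\perp$ is clockwise rotation by $\frac\pi2$, i.e. $(a,b)^\perp = (b,-a)$. For $\vec Z \in \underline{V}^h$ with nodal values in $H$, the discrete length is $L_g^h(\vec Z) = \left( g^{\frac12}(\vec Z), |\vec Z_\rho| \right)^h$. *)

(* Defs.v *)
From HB Require Import structures.
From mathcomp Require Import all_boot all_order all_algebra.
From mathcomp Require Import all_classical all_reals all_analysis.

Set Implicit Arguments.
Unset Strict Implicit.
Unset Printing Implicit Defensive.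

Import Order.TTheory GRing.Theory Num.Theory.
Import numFieldNormedType.Exports.

Local Open Scope classical_set_scope.
Local Open Scope ring_scope.

(* The library norm `|u| on 'rV[R]_2 is the sup norm, so the Euclidean dot
   product and norm are introduced here. The topologies agree. *)
Definition dot (R : realType) (u v : 'rV[R]_2) : R :=
  \sum_(i < 2) u 0 i * v 0 i.

Definition enorm (R : realType) (u : 'rV[R]_2) : R := Num.sqrt (dot u u).

(* Clockwise rotation by pi/2: (a, b) |-> (b, - a). *)
Definition perp (R : realType) (u : 'rV[R]_2) : 'rV[R]_2 :=
  \row_(i < 2) (if i == 0 then u 0 1 else - u 0 0).

Definition partial (R : realType) (i : 'I_2) (f : 'rV[R]_2 -> R) :
  'rV[R]_2 -> R := fun x => 'D_(delta_mx 0 i) f x.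

Definition grad (R : realType) (f : 'rV[R]_2 -> R) (x : 'rV[R]_2) :
  'rV[R]_2 := \row_(i < 2) partial i f x.

Definition iter_partial (R : realType) (s : seq 'I_2) (f : 'rV[R]_2 -> R) :
  'rV[R]_2 -> R := foldr (@partial R) f s.

(* C^infinity on the open set H: all iterated partial derivatives exist and
   are continuous at every point of H. Functions on H are represented by
   functions on the whole plane; as H is open, derivatives at points of H do
   not depend on the values outside H. *)
Definition smooth_on (R : realType) (H : set 'rV[R]_2) (f : 'rV[R]_2 -> R) :=
  forall (s : seq 'I_2) (x : 'rV[R]_2), H x ->
    {for x, continuous (iter_partial s f)} /\
    (forall i : 'I_2, derivable (iter_partial s f) x (delta_mx 0 i)).

Definition convex_on (R : realType) (H : set 'rV[R]_2) (f : 'rV[R]_2 -> R) :=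
  forall u v : 'rV[R]_2, H u -> H v -> f v + dot (grad f v) (u - v) <= f u.

Definition convex_splitting (R : realType) (H : set 'rV[R]_2)
    (g gp gm : 'rV[R]_2 -> R) :=
  [/\ forall z, H z -> differentiable gp z,
      forall z, H z -> differentiable gm z,
      forall z, H z -> g z `^ 2^-1 = gp z + gm z,
      convex_on H gp
    & convex_on H (fun z => - gm z)].

(* Functions on I = R/Z are represented by 1-periodic functions on R. *)

Definition node (R : realType) (J j : nat) : R := j%:R * J%:R^-1.

(* "Linear" on an interval [q_j, q_(j+1)] means affine. *)
Definition Vh (R : realType) (J : nat) (chi : R -> R) :=
  [/\ periodic chi 1,
      continuous chi
    & forall j : nat, (j < J)%N -> exists a b : R,
        forall r : R, node R J j <= r <= node R J j.+1 -> chi r = a + b * r].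

Definition Vh2 (R : realType) (J : nat) (X : R -> 'rV[R]_2) :=
  forall i : 'I_2, Vh J (fun r => X r 0 i).

(* sum over j of h [w (q_j^-) + w (q_(j-1)^+)] / 2, where w is the product of
   the two arguments of the mass lumped inner product *)
Definition lumped (R : realType) (J : nat) (w : R -> R) : R :=
  2^-1 * (\sum_(j < J) (J%:R^-1 *
    (lim (w r @[r --> (node R J j.+1)^'-]) +
     lim (w r @[r --> (node R J j)^'+])))).

Definition mlip (R : realType) (J : nat) (u v : R -> R) : R :=
  lumped J (fun r => u r * v r).

Definition mlip2 (R : realType) (J : nat) (u v : R -> 'rV[R]_2) : R :=
  lumped J (fun r => dot (u r) (v r)).

(* X_rho. At a node, where X may fail to be differentiable, the value of the
   library's total derivative is irrelevant: only one-sided limits at the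
   nodes are used. *)
Definition drho (R : realType) (X : R -> 'rV[R]_2) : R -> 'rV[R]_2 :=
  derive1 X.

Definition nu (R : realType) (X : R -> 'rV[R]_2) (r : R) : 'rV[R]_2 :=
  - ((enorm (drho X r))^-1 *: perp (drho X r)).

Definition discrete_length (R : realType) (J : nat) (g : 'rV[R]_2 -> R)
    (Z : R -> 'rV[R]_2) : R :=
  mlip J (fun r => g (Z r) `^ 2^-1) (fun r => enorm (drho Z r)).

(* In both schemes, X and X' are the polygonal curves at time levels m and
   m+1, and dt is the time step. *)

Definition scheme_C (R : realType) (J : nat) (g gp gm : 'rV[R]_2 -> R)
    (dt : R) (X X' : R -> 'rV[R]_2) (kappa : R -> R) :=
  (forall chi : R -> R, Vh J chi ->
     mlip2 J (fun r => g (X r) *: (dt^-1 *: (X' r - X r)))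
             (fun r => (chi r * enorm (drho X r)) *: nu X r)
     = mlip J (fun r => g (X r) `^ 2^-1 * kappa r)
              (fun r => chi r * enorm (drho X r))) /\
  (forall eta : R -> 'rV[R]_2, Vh2 J eta ->
     mlip2 J (fun r => (g (X r) * kappa r) *: nu X r)
             (fun r => enorm (drho X r) *: eta r)
     + mlip2 J (fun r => grad gp (X' r) + grad gm (X r))
               (fun r => enorm (drho X' r) *: eta r)
     + mlip2 J (fun r => g (X r) `^ 2^-1 *: drho X' r)
               (fun r => (enorm (drho X r))^-1 *: drho eta r)
     = 0).

Definition scheme_D (R : realType) (J : nat) (g gp gm : 'rV[R]_2 -> R)
    (dt : R) (X X' : R -> 'rV[R]_2) (kappa : R -> 'rV[R]_2) :=
  (forall chi : R -> 'rV[R]_2, Vh2 J chi ->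
     mlip2 J (fun r => g (X r) *: (dt^-1 *: (X' r - X r)))
             (fun r => enorm (drho X r) *: chi r)
     = mlip2 J (fun r => g (X r) *: kappa r)
               (fun r => enorm (drho X r) *: chi r)) /\
  (forall eta : R -> 'rV[R]_2, Vh2 J eta ->
     mlip2 J (fun r => g (X r) `^ (3 / 2) *: kappa r)
             (fun r => enorm (drho X r) *: eta r)
     + mlip2 J (fun r => grad gp (X' r) + grad gm (X r))
               (fun r => enorm (drho X' r) *: eta r)
     + mlip2 J (fun r => g (X r) `^ 2^-1 *: drho X' r)
               (fun r => (enorm (drho X r))^-1 *: drho eta r)
     = 0).

(* Main.v *)
Require Import Defs.
From mathcomp Require Import all_boot all_order all_algebra.
From mathcomp Require Import all_classical all_reals all_analysis.
From mathcomp Require Import ring lra.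
Set Implicit Arguments.
Unset Strict Implicit.
Unset Printing Implicit Defensive.

Import Order.TTheory GRing.Theory Num.Theory.
Import numFieldNormedType.Exports.
Local Open Scope classical_set_scope.
Local Open Scope ring_scope.

(** Both inequalities come from testing a scheme with the right functions and
    from one pointwise estimate.

    On each element the derivatives equal the slopes [slope J X j], and once these
    are inserted all integrands are continuous at the nodes. A mass lumped product
    is therefore a [trapezoid] sum of genuine nodal values ([lumpedE]). The only
    integrand whose continuity is not immediate contains the gradients of the two
    parts of the splitting, which are merely assumed differentiable; but a
    differentiable convex function has a continuous gradient
    ([convex_grad_continuous]).

    Testing the second equation with X' - X leaves a curvature term, a gradient
    term and a stiffness term, of sum zero. The gradient and stiffness terms
    together bound the increment of the discrete length from above
    ([length_increment_le]): convexity of the two parts turns the gradient term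
    into an upper bound for the change of the weight, taken with the new length
    elements, and b' . (b' - b) >= |b| (|b'| - |b|) turns the stiffness term into
    an upper bound for the change of the length elements, taken with the old
    weight. The curvature term equals the dissipation. In part (i) this is the
    first equation tested with kappa ([scheme_C_curvature]). In part (ii) the
    test function should be g^(1/2)(X) kappa, which is not piecewise linear;
    mass lumping only sees nodal values, so its interpolant serves as well
    ([scheme_D_curvature]). *)

(** * Euclidean geometry of the plane *)

Lemma dotE (R : realType) (u v : 'rV[R]_2) :
  dot u v = u 0 0 * v 0 0 + u 0 1 * v 0 1.
Proof.
rewrite /dot !big_ord_recl big_ord0 addr0.
by congr (_ + u 0 _ * v 0 _); apply: val_inj.
Qed.

Lemma dotC (R : realType) (u v : 'rV[R]_2) : dot u v = dot v u.
Proof. by rewrite !dotE mulrC [u 0 1 * _]mulrC. Qed.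

Lemma dotZl (R : realType) (a : R) (u v : 'rV[R]_2) :
  dot (a *: u) v = a * dot u v.
Proof. by rewrite !dotE !mxE; ring. Qed.

Lemma dotZr (R : realType) (a : R) (u v : 'rV[R]_2) :
  dot u (a *: v) = a * dot u v.
Proof. by rewrite !dotE !mxE; ring. Qed.

Lemma dotDl (R : realType) (u v w : 'rV[R]_2) :
  dot (u + v) w = dot u w + dot v w.
Proof. by rewrite !dotE !mxE; ring. Qed.

Lemma dotBr (R : realType) (u v w : 'rV[R]_2) :
  dot u (v - w) = dot u v - dot u w.
Proof. by rewrite !dotE !mxE; ring. Qed.

Lemma dotNl (R : realType) (u v : 'rV[R]_2) : dot (- u) v = - dot u v.
Proof. by rewrite !dotE !mxE; ring. Qed.

Lemma dotNr (R : realType) (u v : 'rV[R]_2) : dot u (- v) = - dot u v.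
Proof. by rewrite !dotE !mxE; ring. Qed.

Lemma enorm_ge0 (R : realType) (u : 'rV[R]_2) : 0 <= enorm u.
Proof. exact: sqrtr_ge0. Qed.

Lemma enorm_sqr (R : realType) (u : 'rV[R]_2) : enorm u ^+ 2 = dot u u.
Proof. by rewrite sqr_sqrtr// dotE -!expr2 addr_ge0 ?sqr_ge0. Qed.

(** Cauchy-Schwarz, from Lagrange's identity in the plane. *)
Lemma dot_le_enorm (R : realType) (u v : 'rV[R]_2) :
  dot u v <= enorm u * enorm v.
Proof.
have [duv|duv] := ltP (dot u v) 0.
  by apply: (le_trans (ltW duv)); rewrite mulr_ge0 ?enorm_ge0.
rewrite -(@ler_pXn2r _ 2) ?nnegrE ?mulr_ge0 ?enorm_ge0//.
rewrite exprMn !enorm_sqr !dotE.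
have := sqr_ge0 (u 0 0 * v 0 1 - u 0 1 * v 0 0); nra.
Qed.

(** * Convergence in the plane *)

Lemma rV2_cvg (R : realType) (T : Type) (F : set_system T) {FF : Filter F}
    (f : T -> 'rV[R]_2) (l : 'rV[R]_2) :
  (forall i, f x 0 i @[x --> F] --> l 0 i) -> f x @[x --> F] --> l.
Proof.
move=> fl; rewrite (row_sum_delta l) !big_ord_recl big_ord0 addr0.
rewrite (_ : f = fun x => f x 0 ord0 *: 'e_ord0
                          + f x 0 (lift ord0 ord0) *: 'e_(lift ord0 ord0)).
  by apply: cvgD; apply: cvgZr_tmp; exact: fl.
by apply/funext => x; rewrite {1}(row_sum_delta (f x)) !big_ord_recl big_ord0 addr0.
Qed.

Lemma dot_cvg (R : realType) (T : Type) (F : set_system T) {FF : Filter F}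
    (f g : T -> 'rV[R]_2) (a b : 'rV[R]_2) :
  f x @[x --> F] --> a -> g x @[x --> F] --> b ->
  dot (f x) (g x) @[x --> F] --> dot a b.
Proof.
move=> fa gb.
have coord (u : T -> 'rV[R]_2) (l : 'rV[R]_2) (i : 'I_2) :
    u x @[x --> F] --> l -> u x 0 i @[x --> F] --> l 0 i.
  by move=> ul; exact: (continuous_cvg _ (@coord_continuous _ _ _ 0 i l) ul).
rewrite dotE.
rewrite (_ : (fun x => dot (f x) (g x)) =
  fun x => f x 0 0 * g x 0 0 + f x 0 1 * g x 0 1).
  by apply: cvgD; apply: cvgM; exact: coord.
by apply/funext => x; rewrite dotE.
Qed.

Lemma powR_cvg (R : realType) (T : Type) (F : set_system T) {FF : Filter F}
    (f : T -> R) (a p : R) :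
  0 < a -> f x @[x --> F] --> a -> f x `^ p @[x --> F] --> a `^ p.
Proof.
move=> a0 fa; rewrite {2}/powR gt_eqF//.
apply: (@cvg_trans _ (expR (p * ln (f x)) @[x --> F])).
  apply: near_eq_cvg; near=> x; rewrite /powR gt_eqF//.
  by near: x; exact: (cvgr_gt a fa 0 a0).
apply: continuous_cvg; first exact: continuous_expR.
apply: cvgM; first exact: cvg_cst.
by apply: continuous_cvg fa; exact: continuous_ln.
Unshelve. all: by end_near.
Qed.

Lemma eq_on_open_continuous (T U : topologicalType) (H : set T) (f g : T -> U)
    (z : T) :
  open H -> (forall y, H y -> f y = g y) -> H z ->
  {for z, continuous f} -> {for z, continuous g}.
Proof.
move=> oH fg Hz cf; rewrite /prop_for /continuous_at -(fg z Hz); apply: cvg_trans cf.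
apply: near_eq_cvg; near=> y; apply: fg; near: y; exact: open_nbhs_nbhs.
Unshelve. all: by end_near.
Qed.

(** * Continuity of gradients of convex functions *)

(** The inequality in the hypothesis bounds the derivative at y by the
    difference quotients at y, from above for a step s > 0 and from below for a
    step s < 0. For a fixed step these quotients depend continuously on y, and
    for a short step they are close to the derivative at z when y = z. *)
Lemma convex_derive_continuous (R : realType) (V : normedModType R)
    (H : set V) (f : V -> R) (e z : V) :
  open H -> (forall y, H y -> differentiable f y) ->
  (forall y s, H y -> H (y + s *: e) -> f y + s * 'D_e f y <= f (y + s *: e)) ->
  H z -> {for z, continuous ('D_e f)}.
Proof.
move=> oH df cf Hz.
have right (P : set R) : (0 : R)^' P -> (0 : R)^'+ P.
  by apply: (@filterS _ (nbhs (0 : R)) _ (fun s => s != 0 -> P s)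
    (fun s => 0 < s -> P s)) => s Ps s0; apply/Ps/lt0r_neq0.
have left (P : set R) : (0 : R)^' P -> (0 : R)^'- P.
  by apply: (@filterS _ (nbhs (0 : R)) _ (fun s => s != 0 -> P s)
    (fun s => s < 0 -> P s)) => s Ps s0; apply/Ps/ltr0_neq0.
have shift_cvg (s : R) : y + s *: e @[y --> z] --> z + s *: e.
  by apply: cvgD; [exact: cvg_id | exact: cvg_cst].
have Hs : \forall s \near (0 : R)^', H (z + s *: e).
  have : z + s *: e @[s --> (0:R)^'] --> z + 0 *: e.
    apply: cvgD; first exact: cvg_cst.
    by apply: cvgZr_tmp; apply: cvg_within.
  by apply; apply: open_nbhs_nbhs; split=> //; rewrite scale0r addr0.
have quot : s^-1 * (f (z + s *: e) - f z) @[s --> (0 : R)^'] --> 'D_e f z.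
  have dfe : derivable f z e by exact/diff_derivable/df.
  apply: cvg_trans dfe; apply: near_eq_cvg; near=> s.
  by rewrite /= [z + _]addrC.
have fquot (s : R) : H (z + s *: e) ->
    s^-1 * (f (y + s *: e) - f y) @[y --> z] --> s^-1 * (f (z + s *: e) - f z).
  move=> Hzs; apply: cvgMl_tmp.
  apply: cvgB; last exact: (differentiable_continuous (df _ Hz)).
  exact: (continuous_cvg _ (differentiable_continuous (df _ Hzs)) (shift_cvg s)).
have Hshift (s : R) : H (z + s *: e) -> \forall y \near z, H (y + s *: e).
  by move=> Hzs; apply: (shift_cvg s); exact: open_nbhs_nbhs.
have Hnear : \forall y \near z, H y by exact: open_nbhs_nbhs.
have supp (y : V) (s : R) : H y -> H (y + s *: e) ->
    s * 'D_e f y <= f (y + s *: e) - f y.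
  by move=> Hy Hys; rewrite lerBrDl cf.
apply/cvgrPdist_lt => eps eps0.
(* The steps are fixed first, by differentiability at z alone; y moves afterwards. *)
have [s [s0 Hzs ltD]] : exists s, [/\ 0 < s, H (z + s *: e) &
    s^-1 * (f (z + s *: e) - f z) < 'D_e f z + eps].
  have lt1 := cvgr_lt _ quot ('D_e f z + eps).
  rewrite ltrDl in lt1.
  by case: (filter_ex (filterI (nbhs_right_gt 0)
    (right _ (filterI Hs (lt1 _ eps0))))) => s [s0 [Hzs lts]]; exists s.
have [s' [s'0 Hzs' gtD]] : exists s, [/\ s < 0, H (z + s *: e) &
    'D_e f z - eps < s^-1 * (f (z + s *: e) - f z)].
  have gt1 := cvgr_gt _ quot ('D_e f z - eps).
  rewrite ltrBlDr ltrDl in gt1.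
  by case: (filter_ex (filterI (nbhs_left_lt 0)
    (left _ (filterI Hs (gt1 _ eps0))))) => s' [s'0 [Hzs' gts']]; exists s'.
near=> y.
have Hy : H y by near: y.
have Hys : H (y + s *: e) by near: y; exact: Hshift.
have Hys' : H (y + s' *: e) by near: y; exact: Hshift.
rewrite distrC ltr_norml; apply/andP; split.
  rewrite ltrBrDl; apply: (@lt_le_trans _ _ (s'^-1 * (f (y + s' *: e) - f y))).
    by near: y; exact: (cvgr_gt _ (fquot _ Hzs')).
  by rewrite ler_ndivrMl//; exact: supp.
rewrite ltrBlDl; apply: (@le_lt_trans _ _ (s^-1 * (f (y + s *: e) - f y))).
  by rewrite ler_pdivlMl//; exact: supp.
by near: y; exact: (cvgr_lt _ (fquot _ Hzs)).
Unshelve. all: by end_near.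
Qed.

Lemma dot_delta (R : realType) (u : 'rV[R]_2) (i : 'I_2) :
  dot u (delta_mx 0 i) = u 0 i.
Proof.
rewrite dotE !mxE eqxx /=.
have [->|->] : i = 0 \/ i = 1.
  by case: i => -[|[|//]] ?; [left|right]; apply: val_inj.
- by rewrite /= mulr1 mulr0 addr0.
- by rewrite /= mulr1 mulr0 add0r.
Qed.

Lemma convex_grad_continuous (R : realType) (H : set 'rV[R]_2)
    (f : 'rV[R]_2 -> R) (z : 'rV[R]_2) :
  open H -> (forall y, H y -> differentiable f y) -> convex_on H f ->
  H z -> {for z, continuous (grad f)}.
Proof.
move=> oH df cf Hz; apply: (@rV2_cvg _ _ (nbhs z)) => i.
rewrite (_ : (fun y => grad f y 0 i) = 'D_(delta_mx 0 i) f); last first.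
  by apply/funext => y; rewrite mxE.
rewrite mxE; apply: (@convex_derive_continuous _ _ H f) => // y s Hy Hys.
have := cf _ _ Hys Hy.
by rewrite [y + _]addrC addrK dotZr dot_delta mxE.
Qed.

(** * Mass lumping as a trapezoidal sum *)

(** The integrand depends on the element j because the derivatives jump at the
    nodes: F j is its expression on the j-th element, evaluated at both ends. *)
Definition trapezoid (R : realType) (J : nat) (F : nat -> R -> R) : R :=
  2^-1 * (\sum_(j < J) (J%:R^-1 * (F j (node R J j.+1) + F j (node R J j)))).

Lemma node_lt (R : realType) (J j k : nat) :
  (0 < J)%N -> (j < k)%N -> node R J j < node R J k.
Proof. by move=> J0 jk; rewrite ltr_pM2r ?invr_gt0 ?ltr_nat ?ltr0n. Qed.

(** The values of w at the nodes themselves do not enter the one-sided limits, so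
    w need only agree with F j inside the j-th element. Continuity of F j is asked
    for at the nodes alone, since between them a curve with nodal values in H may
    leave H. *)
Lemma lumpedE (R : realType) (J : nat) (w : R -> R) (F : nat -> R -> R) :
  (forall j r, (j < J)%N -> node R J j < r < node R J j.+1 -> w r = F j r) ->
  (forall j k, (j < J)%N -> (k <= J)%N ->
     F j r @[r --> node R J k] --> F j (node R J k)) ->
  lumped J w = trapezoid J F.
Proof.
move=> wF cF; congr (_ * _); apply: eq_bigr => j _; congr (_ * (_ + _)).
- have lt_node : node R J j < node R J j.+1.
    by apply: node_lt => //; exact: leq_ltn_trans (ltn_ord j).
  apply: cvg_lim => //.
  apply: (@cvg_trans _ (F j r @[r --> (node R J j.+1)^'-])).
    apply: near_eq_cvg; near=> r; apply/esym/wF => //; apply/andP; split.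
      by near: r; exact: nbhs_left_gt.
    by near: r; exact: nbhs_left_lt.
  by apply: cvg_at_left_filter; exact: cF.
- have lt_node : node R J j < node R J j.+1.
    by apply: node_lt => //; exact: leq_ltn_trans (ltn_ord j).
  apply: cvg_lim => //.
  apply: (@cvg_trans _ (F j r @[r --> (node R J j)^'+])).
    apply: near_eq_cvg; near=> r; apply/esym/wF => //; apply/andP; split.
      by near: r; exact: nbhs_right_gt.
    by near: r; exact: nbhs_right_lt.
  by apply: cvg_at_right_filter; apply: cF => //; exact: ltnW.
Unshelve. all: by end_near.
Qed.

Lemma trapezoidD (R : realType) (J : nat) (F G : nat -> R -> R) :
  trapezoid J (fun j r => F j r + G j r) = trapezoid J F + trapezoid J G.
Proof.
rewrite /trapezoid -mulrDr -big_split; congr (_ * _).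
by apply: eq_bigr => j _ /=; rewrite -mulrDr addrACA.
Qed.

Lemma trapezoidZ (R : realType) (J : nat) (a : R) (F : nat -> R -> R) :
  trapezoid J (fun j r => a * F j r) = a * trapezoid J F.
Proof.
rewrite /trapezoid mulrCA; congr (_ * _); rewrite mulr_sumr.
by apply: eq_bigr => j _; rewrite -mulrDr mulrCA.
Qed.

Lemma le_trapezoid (R : realType) (J : nat) (F G : nat -> R -> R) :
  (forall j k, (j < J)%N -> (k <= J)%N -> F j (node R J k) <= G j (node R J k)) ->
  trapezoid J F <= trapezoid J G.
Proof.
move=> FG; rewrite ler_pM2l ?invr_gt0//; apply: ler_sum => j _.
by rewrite ler_wpM2l ?invr_ge0// lerD ?FG// ltnW.
Qed.

Lemma eq_trapezoid (R : realType) (J : nat) (F G : nat -> R -> R) :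
  (forall j k, (j < J)%N -> (k <= J)%N -> F j (node R J k) = G j (node R J k)) ->
  trapezoid J F = trapezoid J G.
Proof.
by move=> FG; apply/eqP; rewrite eq_le !le_trapezoid// => j k jJ kJ; rewrite FG.
Qed.

Lemma lumpedZ (R : realType) (J : nat) (a : R) (w : R -> R) (F : nat -> R -> R) :
  (forall j r, (j < J)%N -> node R J j < r < node R J j.+1 -> w r = F j r) ->
  (forall j k, (j < J)%N -> (k <= J)%N ->
     F j r @[r --> node R J k] --> F j (node R J k)) ->
  lumped J (fun r => a * w r) = a * lumped J w.
Proof.
move=> wF cF; rewrite (lumpedE wF cF) -trapezoidZ; apply: lumpedE.
  by move=> j r jJ rj; rewrite (wF j).
by move=> j k jJ kJ; apply: cvgMl_tmp; exact: cF.
Qed.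

(** * Piecewise linear curves *)

Definition slope (R : realType) (J : nat) (X : R -> 'rV[R]_2) (j : nat) :
  'rV[R]_2 := J%:R *: (X (node R J j.+1) - X (node R J j)).

Lemma Vh2_continuous (R : realType) (J : nat) (X : R -> 'rV[R]_2) :
  Vh2 J X -> continuous X.
Proof.
by move=> XV r; apply: rV2_cvg => i; have [_ cX _] := XV i; exact: cX.
Qed.

Lemma Vh2_affine (R : realType) (J : nat) (X : R -> 'rV[R]_2) (j : nat) :
  Vh2 J X -> (j < J)%N -> forall r, node R J j <= r <= node R J j.+1 ->
  X r = X (node R J j) + (r - node R J j) *: slope J X j.
Proof.
move=> XV jJ r rj; apply/rowP => i; have [_ _ /(_ j jJ)[a [b ab]]] := XV i.
have J0 : (0 < J)%N by exact: leq_ltn_trans jJ.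
have lt_node : node R J j < node R J j.+1 by exact: node_lt.
rewrite !mxE ab// !ab ?lexx ?ltW//.
have -> : node R J j.+1 = node R J j + J%:R^-1.
  by rewrite /node -natr1 mulrDl mul1r.
by field; rewrite pnatr_eq0 -lt0n.
Qed.

Lemma drho_slope (R : realType) (J : nat) (X : R -> 'rV[R]_2) (j : nat) (r : R) :
  Vh2 J X -> (j < J)%N -> node R J j < r < node R J j.+1 ->
  drho X r = slope J X j.
Proof.
move=> XV jJ /andP[jr rj]; rewrite /drho derive1E.
pose L (s : R) := X (node R J j) + (s - node R J j) *: slope J X j.
have -> : 'D_1 X r = 'D_1 L r.
  apply: near_eq_derive; near=> s; apply: Vh2_affine => //; apply/andP; split.
    by apply: ltW; near: s; exact: lt_nbhsr.
  by apply: ltW; near: s; exact: lt_nbhsl.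
apply: cvg_lim => //; apply: cvg_near_cst; near=> h.
rewrite (_ : _ - L r = h *: slope J X j).
  rewrite scalerA mulVf ?scale1r//; near: h; exact: nbhs_dnbhs_neq.
by apply/rowP => i; rewrite /L /= !mxE /GRing.scale /=; ring.
Unshelve. all: by end_near.
Qed.

Lemma VhB (R : realType) (J : nat) (f g : R -> R) :
  Vh J f -> Vh J g -> Vh J (fun r => f r - g r).
Proof.
move=> [pf cf af] [pg cg ag]; split.
- by move=> r; rewrite pf pg.
- by move=> r; apply: cvgB; [exact: cf | exact: cg].
- move=> j jJ; have [a [b fab]] := af j jJ; have [c [d gcd]] := ag j jJ.
  by exists (a - c), (b - d) => r rj; rewrite fab// gcd//; ring.
Qed.

Lemma Vh2B (R : realType) (J : nat) (X Y : R -> 'rV[R]_2) :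
  Vh2 J X -> Vh2 J Y -> Vh2 J (fun r => X r - Y r).
Proof.
move=> XV YV i; have := VhB (XV i) (YV i).
by congr (Vh J _); apply/funext => r; rewrite !mxE.
Qed.

Lemma slopeB (R : realType) (J : nat) (X Y : R -> 'rV[R]_2) (j : nat) :
  slope J (fun r => X r - Y r) j = slope J X j - slope J Y j.
Proof. by apply/rowP => i; rewrite !mxE; ring. Qed.

Lemma Vh2_periodic (R : realType) (J : nat) (X : R -> 'rV[R]_2) :
  Vh2 J X -> periodic X 1.
Proof. by move=> XV r; apply/rowP => i; have [-> _ _] := XV i. Qed.

(** The node 0 is the node J, by periodicity. *)
Lemma Vh2_node (R : realType) (J : nat) (H : set 'rV[R]_2) (X : R -> 'rV[R]_2) :
  (0 < J)%N -> Vh2 J X ->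
  (forall j, (1 <= j <= J)%N -> H (X (node R J j))) ->
  forall k, (k <= J)%N -> H (X (node R J k)).
Proof.
move=> J0 XV XH [|k] kJ; last exact: XH.
have -> : X (node R J 0) = X (node R J J).
  have -> : node R J J = node R J 0 + 1.
    by rewrite /node mul0r add0r divff// pnatr_eq0 -lt0n.
  by apply/rowP => i; have [/(_ (node R J 0)) -> _ _] := XV i.
by apply: XH; rewrite J0 leqnn.
Qed.

(** A vanishing slope would make the derivative vanish on a whole element, which
    is not a null set. *)
Lemma slope_enorm_gt0 (R : realType) (J : nat) (X : R -> 'rV[R]_2) (j : nat) :
  Vh2 J X ->
  {ae @lebesgue_measure R, forall r, 0 <= r <= 1 -> 0 < enorm (drho X r)} ->
  (j < J)%N -> 0 < enorm (slope J X j).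
Proof.
move=> XV [A [mA A0 subA]] jJ; rewrite lt_neqAle enorm_ge0 andbT.
apply/eqP => slope0.
have J0 : (0 < J)%N by exact: leq_ltn_trans jJ.
have lt_node : node R J j < node R J j.+1 by exact: node_lt.
have subI : `]node R J j, node R J j.+1[%classic `<=` A.
  move=> r /=; rewrite in_itv /= => /[dup] rj /andP[jr rj1]; apply: subA => Xr.
  have : 0 < enorm (drho X r).
    apply: Xr; rewrite (le_trans _ (ltW jr)) ?divr_ge0 ?ler0n//=.
    by rewrite (le_trans (ltW rj1))// ler_pdivrMr ?ltr0n// mul1r ler_nat.
  by rewrite (drho_slope XV jJ rj) -slope0 ltxx.
have : (@lebesgue_measure R `]node R J j, node R J j.+1[%classic <= 0)%E.
  by rewrite -A0; apply: le_measure; rewrite ?inE//; exact: measurable_itv.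
rewrite lebesgue_measure_itv /= lte_fin lt_node -EFinB lee_fin subr_le0.
by rewrite leNgt lt_node.
Qed.

(** * Piecewise linear interpolation *)

(** The floor of r * J is the index of the element containing r. Letting it run
    over all integers, rather than over 0, ..., J - 1, makes the interpolant of a
    periodic function periodic without any reduction modulo J. *)
Definition interpolant (R : realType) (J : nat) (f : R -> R) (r : R) : R :=
  let k := Num.floor (r * J%:R) in
  f (k%:~R / J%:R) +
  (f ((k + 1)%:~R / J%:R) - f (k%:~R / J%:R)) * (r * J%:R - k%:~R).

(** The right end is included: there the floor jumps to k + 1, and both affine
    expressions take the value of f at that node. *)
Lemma interpolant_affine (R : realType) (J : nat) (f : R -> R) (k : int) (r : R) :
  k%:~R <= r * J%:R <= (k + 1)%:~R ->
  interpolant J f r = f (k%:~R / J%:R) +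
    (f ((k + 1)%:~R / J%:R) - f (k%:~R / J%:R)) * (r * J%:R - k%:~R).
Proof.
rewrite /interpolant => /andP[kr]; rewrite le_eqVlt => /orP[/eqP rk|rk].
  rewrite rk (@floor_def _ _ (k + 1)) ?lexx ?ltr_int ?ltrDl//.
  have -> : (k + 1)%:~R - k%:~R = 1 :> R by rewrite intrD addrAC subrr add0r.
  by rewrite subrr mulr0 addr0 mulr1 subrKC.
by rewrite (@floor_def _ _ k) ?kr.
Qed.

Lemma interpolant_node (R : realType) (J k : nat) (f : R -> R) :
  (0 < J)%N -> interpolant J f (node R J k) = f (node R J k).
Proof.
move=> J0; have J0' : J%:R != 0 :> R by rewrite pnatr_eq0 -lt0n.
rewrite (@interpolant_affine _ _ _ k%:Z) /node -?pmulrn.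
  by rewrite divfK// subrr mulr0 addr0.
by rewrite divfK// lexx ler_nat leq_addr.
Qed.

Lemma interpolant_Vh (R : realType) (J : nat) (f : R -> R) :
  (0 < J)%N -> periodic f 1 -> Vh J (interpolant J f).
Proof.
move=> J0 fper; have J0' : J%:R != 0 :> R by rewrite pnatr_eq0 -lt0n.
split.
- move=> r; rewrite /interpolant mulrDl mul1r floorDrz; last exact: natr_int.
  have -> : Num.floor (J%:R : R) = J%:Z by exact: (intrKfloor J%:Z).
  have shiftJ (k : int) : f ((k + J%:Z)%:~R / J%:R) = f (k%:~R / J%:R).
    by rewrite -[RHS]fper intrD mulrDl -pmulrn divff.
  by rewrite addrAC !shiftJ intrD -pmulrn opprD addrACA subrr addr0.
- move=> r; have [k krk1] : exists k : int, k%:~R <= r * J%:R < (k + 1)%:~R.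
    by exists (Num.floor (r * J%:R)); exact: floor_itv.
  pose sl := f (k%:~R / J%:R) - f ((k - 1)%:~R / J%:R).
  pose sr := f ((k + 1)%:~R / J%:R) - f (k%:~R / J%:R).
  (* On the two elements around the k-th node, a function that is affine on each
     side is an affine function plus a multiple of the absolute value; in
     this form P, continuity at the node is that of its ingredients. *)
  pose P s := f (k%:~R / J%:R) + (sr + sl) / 2 * (s * J%:R - k%:~R)
              + (sr - sl) / 2 * `|s * J%:R - k%:~R|.
  have PE s : (k - 1)%:~R <= s * J%:R <= (k + 1)%:~R -> interpolant J f s = P s.
    move=> /andP[ks sk]; have [ks'|/ltW sk'] := leP k%:~R (s * J%:R).
      rewrite (@interpolant_affine _ _ _ k) ?ks'// -/sr /P ger0_norm ?subr_ge0//.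
      by field.
    rewrite (@interpolant_affine _ _ _ (k - 1)) ?subrK ?ks// -/sl /P.
    rewrite ler0_norm ?subr_le0// [f ((k - 1)%:~R / _)](_ : _ = f (k%:~R / J%:R) - sl).
      by rewrite intrB; field.
    by rewrite /sl subKr.
  have lt_k : (k - 1)%:~R < k%:~R :> R by rewrite ltr_int gtrBl.
  have /andP[kr rk] := krk1.
  have lin : s * J%:R - k%:~R @[s --> r] --> r * J%:R - k%:~R.
    by apply: cvgB; [apply: cvgMr_tmp; exact: cvg_id | exact: cvg_cst].
  have cP : P s @[s --> r] --> P r.
    apply: cvgD; last by apply: cvgMl_tmp; exact: cvg_norm lin.
    by apply: cvgD; [exact: cvg_cst | exact: cvgMl_tmp].
  rewrite /continuous_at PE; last by rewrite (ltW (lt_le_trans lt_k kr)) ltW.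
  apply: cvg_trans cP.
  apply: near_eq_cvg; near=> s; apply/esym/PE/andP; split.
    rewrite -ler_pdivrMr ?ltr0n//; apply: ltW; near: s; apply: lt_nbhsr.
    by rewrite ltr_pdivrMr ?ltr0n// (lt_le_trans lt_k).
  rewrite -ler_pdivlMr ?ltr0n//; apply: ltW; near: s; apply: lt_nbhsl.
  by rewrite ltr_pdivlMr ?ltr0n.
- move=> j jJ; set a := f (node R J j); set d := f (node R J j.+1) - a.
  exists (a - d * j%:R), (d * J%:R) => r; rewrite /node => /andP[jr rj].
  rewrite ler_pdivrMr ?ltr0n// in jr; rewrite ler_pdivlMr ?ltr0n// in rj.
  rewrite (@interpolant_affine _ _ _ j%:Z) -?[(j%:Z + 1)%R]/(j + 1)%:Z ?addn1;
    rewrite -?pmulrn; last by apply/andP.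
  rewrite -/(node R J j) -/(node R J j.+1) -/a -/d; ring.
Unshelve. all: by end_near.
Qed.

(** * The energy estimate *)

(** New and old quantities are compared at each node of each element separately,
    with slopes b', b and weights w', w:
    w' |b'| - w |b| = (w' - w) |b'| + w (|b'| - |b|), where the first summand is
    controlled by convexity of the two parts of the splitting and the second by
    Cauchy-Schwarz. The part gp has its gradient at the new point and gm at the
    old one, because gp is convex and gm is concave. *)
Lemma length_increment_le (R : realType) (H : set 'rV[R]_2)
    (g gp gm : 'rV[R]_2 -> R) (J : nat) (X X' : R -> 'rV[R]_2) :
  open H -> (forall z, H z -> 0 < g z) -> smooth_on H g ->
  convex_splitting H g gp gm -> (0 < J)%N -> Vh2 J X -> Vh2 J X' ->
  (forall k, (k <= J)%N -> H (X (node R J k))) ->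
  (forall k, (k <= J)%N -> H (X' (node R J k))) ->
  (forall j, (j < J)%N -> 0 < enorm (slope J X j)) ->
  discrete_length J g X' - discrete_length J g X <=
    mlip2 J (fun r => grad gp (X' r) + grad gm (X r))
            (fun r => enorm (drho X' r) *: (X' r - X r))
    + mlip2 J (fun r => g (X r) `^ 2^-1 *: drho X' r)
        (fun r => (enorm (drho X r))^-1 *: drho (fun s => X' s - X s) r).
Proof.
move=> oH g0 sg [dgp dgm gE cgp cgm] J0 XV X'V XH X'H Xreg.
have gcont z : H z -> {for z, continuous g} by move=> Hz; have [] := sg [::] z Hz.
have dNgm z : H z -> differentiable (fun y => - gm y) z.
  by move=> /dgm dz; exact: differentiableN.
have gradN z : H z -> grad (fun y => - gm y) z = - grad gm z.
  move=> Hz; apply/rowP => i; rewrite !mxE /partial deriveN//.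
  exact/diff_derivable/dgm.
have cont_gp z : H z -> {for z, continuous (grad gp)}.
  by move=> Hz; exact: (@convex_grad_continuous _ H).
have cont_gm z : H z -> {for z, continuous (grad gm)}.
  move=> Hz; have : {for z, continuous (grad (fun y => - gm y))}.
    exact: (@convex_grad_continuous _ H).
  move=> cN; apply: (@eq_on_open_continuous _ _ H
      (fun y => - grad (fun y => - gm y) y)) => //.
    by move=> y Hy; rewrite gradN// opprK.
  exact: (@cvgN _ _ _ (nbhs z)).
have cX r : X s @[s --> r] --> X r by exact: Vh2_continuous.
have cX' r : X' s @[s --> r] --> X' r by exact: Vh2_continuous.
have cg (Y : R -> 'rV[R]_2) r : Y s @[s --> r] --> Y r -> H (Y r) ->
    g (Y s) `^ 2^-1 @[s --> r] --> g (Y r) `^ 2^-1.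
  move=> cY HY; apply: powR_cvg; first exact: g0.
  by apply: continuous_cvg cY; exact: gcont.
rewrite /discrete_length /mlip /mlip2.
rewrite (@lumpedE _ J _ (fun j r =>
  g (X' r) `^ 2^-1 * enorm (slope J X' j))); last 2 first.
- by move=> j r jJ rj; rewrite (drho_slope X'V jJ rj).
- by move=> j k jJ kJ; apply: cvgM; [apply: cg => //; exact: X'H | exact: cvg_cst].
rewrite (@lumpedE _ J _ (fun j r =>
  g (X r) `^ 2^-1 * enorm (slope J X j))); last 2 first.
- by move=> j r jJ rj; rewrite (drho_slope XV jJ rj).
- by move=> j k jJ kJ; apply: cvgM; [apply: cg => //; exact: XH | exact: cvg_cst].
rewrite (@lumpedE _ J _ (fun j r => dot (grad gp (X' r) + grad gm (X r))
  (enorm (slope J X' j) *: (X' r - X r)))); last 2 first.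
- by move=> j r jJ rj; rewrite (drho_slope X'V jJ rj).
- move=> j k jJ kJ; apply: dot_cvg; last first.
    by apply: cvgZ; [exact: cvg_cst | exact: (cvgB (cX' _) (cX _))].
  apply: cvgD.
    by apply: continuous_cvg (cX' _); exact/cont_gp/X'H.
  by apply: continuous_cvg (cX _); exact/cont_gm/XH.
rewrite (@lumpedE _ J _ (fun j r => dot (g (X r) `^ 2^-1 *: slope J X' j)
  ((enorm (slope J X j))^-1 *: (slope J X' j - slope J X j)))); last 2 first.
- move=> j r jJ rj; rewrite (drho_slope X'V jJ rj) (drho_slope XV jJ rj).
  by rewrite (drho_slope (Vh2B X'V XV) jJ rj) slopeB.
- move=> j k jJ kJ; apply: dot_cvg; last exact: cvg_cst.
  by apply: cvgZ; [apply: cg => //; exact: XH | exact: cvg_cst].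
rewrite lerBlDr -!trapezoidD; apply: le_trapezoid => j k jJ kJ.
have := Xreg j jJ; move: (slope J X j) (slope J X' j) => b b' b_gt0.
have := XH k kJ; have := X'H k kJ.
move: (X (node R J k)) (X' (node R J k)) => x x' Hx' Hx.
have hgp := cgp x x' Hx Hx'; have hgm := cgm x' x Hx' Hx.
rewrite gradN// in hgm; rewrite !gE//.
have g12 : 0 <= gp x + gm x by rewrite -gE// powR_ge0.
have potential : gp x' + gm x' - (gp x + gm x)
    <= dot (grad gp x' + grad gm x) (x' - x).
  move: hgp hgm; rewrite -[x - x']opprB dotNr dotNl dotDl; lra.
have kinetic : enorm b' - enorm b <= (enorm b)^-1 * dot b' (b' - b).
  rewrite ler_pdivlMl// dotBr -enorm_sqr.
  have := dot_le_enorm b' b; have := sqr_ge0 (enorm b' - enorm b); nra.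
rewrite dotZr dotZl dotZr.
have := ler_wpM2l g12 kinetic; have := ler_wpM2l (enorm_ge0 b') potential; nra.
Qed.

(** The left-hand side is dt times that of the first equation of the scheme
    tested with kappa: the scalar kappa moves freely between the two arguments of
    the dot product. *)
Lemma scheme_C_curvature (R : realType) (H : set 'rV[R]_2)
    (g gp gm : 'rV[R]_2 -> R) (J : nat) (dt : R) (X X' : R -> 'rV[R]_2)
    (kappa : R -> R) :
  (forall z, H z -> {for z, continuous g}) -> 0 < dt ->
  Vh2 J X -> Vh2 J X' -> Vh J kappa ->
  (forall k, (k <= J)%N -> H (X (node R J k))) ->
  scheme_C J g gp gm dt X X' kappa ->
  mlip2 J (fun r => (g (X r) * kappa r) *: nu X r)
          (fun r => enorm (drho X r) *: (X' r - X r))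
  = dt * mlip J (fun r => g (X r) `^ 2^-1 * `|kappa r| ^+ 2)
                (fun r => enorm (drho X r)).
Proof.
move=> gcont dt0 XV X'V kV XH [/(_ kappa kV) eqX _].
have -> : mlip J (fun r => g (X r) `^ 2^-1 * `|kappa r| ^+ 2)
                 (fun r => enorm (drho X r)) =
    mlip J (fun r => g (X r) `^ 2^-1 * kappa r)
           (fun r => kappa r * enorm (drho X r)).
  by congr (lumped J _); apply/funext => r; rewrite real_normK ?num_real//; ring.
rewrite -eqX /mlip2.
rewrite -(@lumpedZ _ J dt _ (fun j r => dot (g (X r) *: (dt^-1 *: (X' r - X r)))
   ((kappa r * enorm (slope J X j)) *:
      (- ((enorm (slope J X j))^-1 *: perp (slope J X j)))))).
- congr (lumped J _); apply/funext => r; rewrite !(dotZl, dotZr) dotC.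
  by field; rewrite gt_eqF.
- by move=> j r jJ rj; rewrite /nu (drho_slope XV jJ rj).
- move=> j k jJ kJ.
  have cX := @Vh2_continuous _ _ _ XV (node R J k).
  have cX' := @Vh2_continuous _ _ _ X'V (node R J k).
  have [_ ck _] := kV; have {}ck := ck (node R J k).
  apply: dot_cvg.
    apply: cvgZ; last by apply: cvgZ; [exact: cvg_cst | exact: cvgB cX' cX].
    by apply: continuous_cvg cX; exact/gcont/XH.
  apply: cvgZ; last exact: cvg_cst.
  by apply: cvgM; [exact: ck | exact: cvg_cst].
Qed.

(** The first equation of the scheme has the weight g, one factor g^(1/2) short
    of the claim; the missing factor is put into the test function. *)
Lemma scheme_D_curvature (R : realType) (H : set 'rV[R]_2)
    (g gp gm : 'rV[R]_2 -> R) (J : nat) (dt : R) (X X' kappa : R -> 'rV[R]_2) :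
  (forall z, H z -> {for z, continuous g}) -> (forall z, H z -> 0 < g z) ->
  (0 < J)%N -> 0 < dt -> Vh2 J X -> Vh2 J X' -> Vh2 J kappa ->
  (forall k, (k <= J)%N -> H (X (node R J k))) ->
  scheme_D J g gp gm dt X X' kappa ->
  mlip2 J (fun r => g (X r) `^ (3 / 2) *: kappa r)
          (fun r => enorm (drho X r) *: (X' r - X r))
  = dt * mlip J (fun r => g (X r) `^ (3 / 2) * enorm (kappa r) ^+ 2)
                (fun r => enorm (drho X r)).
Proof.
move=> gcont g0 J0 dt0 XV X'V kV XH [eqX _].
(* the nodal interpolant of g^(1/2)(X) kappa *)
pose chi r : 'rV[R]_2 :=
  \row_i interpolant J (fun s => g (X s) `^ 2^-1 * kappa s 0 i) r.
have chiV : Vh2 J chi.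
  move=> i; have -> : (fun r => chi r 0 i) =
      interpolant J (fun s => g (X s) `^ 2^-1 * kappa s 0 i).
    by apply/funext => r; rewrite mxE.
  by apply: interpolant_Vh => // r; rewrite (Vh2_periodic XV) (Vh2_periodic kV).
have chi_node k : chi (node R J k) =
    g (X (node R J k)) `^ 2^-1 *: kappa (node R J k).
  by apply/rowP => i; rewrite !mxE interpolant_node.
have g32 z : H z -> g z `^ (3 / 2) = g z * g z `^ 2^-1.
  move=> /g0 gz0; rewrite (_ : 3 / 2 = 1 + 2^-1); last by field.
  by rewrite powRD ?powRr1 ?ltW// gt_eqF// implybT.
have {}eqX := eqX chi chiV.
have cX r : X s @[s --> r] --> X r by exact: Vh2_continuous.
have cX' r : X' s @[s --> r] --> X' r by exact: Vh2_continuous.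
have ck r : kappa s @[s --> r] --> kappa r by exact: Vh2_continuous.
have cchi r : chi s @[s --> r] --> chi r by exact: Vh2_continuous.
have cgX k : (k <= J)%N ->
    g (X s) @[s --> node R J k] --> g (X (node R J k)).
  by move=> kJ; apply: continuous_cvg (cX _); exact/gcont/XH.
have cg32 k : (k <= J)%N ->
    g (X s) `^ (3 / 2) @[s --> node R J k] --> g (X (node R J k)) `^ (3 / 2).
  by move=> kJ; apply: powR_cvg; [exact/g0/XH | exact: cgX].
have cscale (c : R) (Y : R -> 'rV[R]_2) (q : R) : Y s @[s --> q] --> Y q ->
    c *: Y s @[s --> q] --> c *: Y q.
  by move=> cY; apply: cvgZ; [exact: cvg_cst | exact: cY].
pose e j := enorm (slope J X j).
move: eqX; rewrite /mlip2 /mlip.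
rewrite (@lumpedE _ J _ (fun j r =>
  dot (g (X r) *: (dt^-1 *: (X' r - X r))) (e j *: chi r))); last 2 first.
- by move=> j r jJ rj; rewrite (drho_slope XV jJ rj).
- move=> j k jJ kJ; apply: dot_cvg; last exact/cscale/cchi.
  by apply: cvgZ; [exact: cgX | apply: cscale; exact: cvgB (cX' _) (cX _)].
rewrite (@lumpedE _ J _ (fun j r =>
  dot (g (X r) *: kappa r) (e j *: chi r))); last 2 first.
- by move=> j r jJ rj; rewrite (drho_slope XV jJ rj).
- move=> j k jJ kJ; apply: dot_cvg; last exact/cscale/cchi.
  by apply: cvgZ; [exact: cgX | exact: ck].
rewrite (@lumpedE _ J _ (fun j r =>
  dot (g (X r) `^ (3 / 2) *: kappa r) (e j *: (X' r - X r)))); last 2 first.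
- by move=> j r jJ rj; rewrite (drho_slope XV jJ rj).
- move=> j k jJ kJ; apply: dot_cvg; last by apply: cscale; exact: cvgB (cX' _) (cX _).
  by apply: cvgZ; [exact: cg32 | exact: ck].
rewrite (@lumpedE _ J _ (fun j r =>
  g (X r) `^ (3 / 2) * enorm (kappa r) ^+ 2 * e j)); last 2 first.
- by move=> j r jJ rj; rewrite (drho_slope XV jJ rj).
- move=> j k jJ kJ; apply: cvgM; last exact: cvg_cst.
  apply: cvgM; first exact: cg32.
  rewrite enorm_sqr; under eq_cvg do rewrite enorm_sqr.
  exact: dot_cvg (ck _) (ck _).
move=> eqX.
rewrite [X in _ = dt * X](_ : _ = trapezoid J (fun j r =>
   dot (g (X r) *: kappa r) (e j *: chi r))); last first.
  apply: eq_trapezoid => j k jJ kJ.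
  by rewrite chi_node !(dotZl, dotZr) g32 ?enorm_sqr; [ring | exact: XH].
rewrite -eqX -trapezoidZ; apply: eq_trapezoid => j k jJ kJ.
rewrite chi_node !(dotZl, dotZr) g32; last exact: XH.
by rewrite [dot (kappa _) _]dotC; field; rewrite gt_eqF.
Qed.

Theorem theorem3p5 (R : realType) (H : set 'rV[R]_2)
    (g gp gm : 'rV[R]_2 -> R) (J M : nat) (T : R) (t : nat -> R) (m : nat)
    (X : R -> 'rV[R]_2)
    (H_open : open H)
    (g_gt0 : forall z, H z -> 0 < g z)
    (g_smooth : smooth_on H g)
    (g_split : convex_splitting H g gp gm)
    (J_ge3 : (3 <= J)%N)
    (t_first : t 0%N = 0)
    (t_incr : forall n : nat, (n < M)%N -> t n < t n.+1)
    (t_last : t M = T)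
    (m_lt : (m < M)%N)
    (X_Vh : Vh2 J X)
    (X_H : forall j : nat, (1 <= j <= J)%N -> H (X (node R J j)))
    (X_reg : {ae @lebesgue_measure R, forall r : R,
                0 <= r <= 1 -> 0 < enorm (drho X r)}) :
  (forall (X' : R -> 'rV[R]_2) (kappa : R -> R),
     Vh2 J X' -> Vh J kappa ->
     (forall j : nat, (1 <= j <= J)%N -> H (X' (node R J j))) ->
     scheme_C J g gp gm (t m.+1 - t m) X X' kappa ->
     discrete_length J g X'
     + (t m.+1 - t m) *
       mlip J (fun r => g (X r) `^ 2^-1 * `|kappa r| ^+ 2)
              (fun r => enorm (drho X r))
     <= discrete_length J g X) /\
  (forall (X' kappa : R -> 'rV[R]_2),
     Vh2 J X' -> Vh2 J kappa ->
     (forall j : nat, (1 <= j <= J)%N -> H (X' (node R J j))) ->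
     scheme_D J g gp gm (t m.+1 - t m) X X' kappa ->
     discrete_length J g X'
     + (t m.+1 - t m) *
       mlip J (fun r => g (X r) `^ (3 / 2) * enorm (kappa r) ^+ 2)
              (fun r => enorm (drho X r))
     <= discrete_length J g X).
Proof.
have J0 : (0 < J)%N by exact: leq_trans J_ge3.
have dt0 : 0 < t m.+1 - t m by rewrite subr_gt0 t_incr.
have gcont z : H z -> {for z, continuous g}.
  by move=> Hz; have [] := g_smooth [::] z Hz.
have XH := Vh2_node J0 X_Vh X_H.
have Xreg j : (j < J)%N -> 0 < enorm (slope J X j).
  exact: slope_enorm_gt0 X_Vh X_reg.
split=> [X' kappa X'V kV X'_H eqs | X' kappa X'V kV X'_H eqs].
- have X'H := Vh2_node J0 X'V X'_H.
  have incr := length_increment_le H_open g_gt0 g_smooth g_split J0 X_Vh X'V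
    XH X'H Xreg.
  rewrite -(scheme_C_curvature gcont dt0 X_Vh X'V kV XH eqs).
  have [_ /(_ _ (Vh2B X'V X_Vh))/eqP] := eqs.
  by rewrite -addrA addr_eq0 => /eqP ->; rewrite lerBlDr -lerBlDl.
- have X'H := Vh2_node J0 X'V X'_H.
  have incr := length_increment_le H_open g_gt0 g_smooth g_split J0 X_Vh X'V
    XH X'H Xreg.
  rewrite -(scheme_D_curvature gcont g_gt0 J0 dt0 X_Vh X'V kV XH eqs).
  have [_ /(_ _ (Vh2B X'V X_Vh))/eqP] := eqs.
  by rewrite -addrA addr_eq0 => /eqP ->; rewrite lerBlDr -lerBlDl.
Qed.
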